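(* Let $M\ge1$ and $N_0$ be integers, $B,\varepsilon,\delta$ real numbers, and $(m_i),(p_i)$ integer sequences. Suppose $U(1,N_0)$ is $(M,B,\varepsilon,\delta)$-rigid with coefficients $m_i,p_i$. Then for every integer $N>N_0$, $U(1,N)$ is $(M,B,\varepsilon,\delta)$-rigid with coefficients $m_i,p_i$.
   Context: For an integer $n\ge2$, $U(1,n)$ is the Ulam sequence: the increasing sequence with first terms $1,n$, each subsequent term being the smallest integer larger than the previous term that is a sum $u+v$ of two earlier terms $u<v$ in exactly one way. Write $U(1,n)$ uniquely as a disjoint union $\bigsqcup_{i\ge1}([a_i(n),b_i(n)]\cap\mathbb{Z})$ of maximal runs of consecutive integers with $b_{i-1}(n)<a_i(n)\le b_i(n)$ and $b_i(n)+1<a_{i+1}(n)$; these are the intervals of $U(1,n)$, the $i$-th having endpoints $a_i(n),b_i(n)$. For integers $n\ge3$, $M\ge1$, reals $B,\varepsilon,\delta$ and integers $m_i,p_i$, say $U(1,n)$ is $(M,B,\varepsilon,\delta)$-rigid with coefficients $m_i,p_i$ if $n>4\max(\varepsilon,\delta)-B+4$ and for every $1\le i\le M$ there are reals $\varepsilon_i,\delta_i$ with $|\varepsilon_i|<\varepsilon$, $|\delta_i|<\delta$ such that for both $N\in\{n-1,n\}$: $a_i(N)=(N+B)m_i+\varepsilon_i$ and $b_i(N)=(N+B)p_i+\delta_i$. *)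

(* Defs.v *)
From mathcomp Require Import all_boot all_order all_algebra.
From mathcomp Require Import zify.
From mathcomp Require Import boolp classical_sets reals.
Set Implicit Arguments.
Unset Strict Implicit.
Unset Printing Implicit Defensive.
Import Order.TTheory GRing.Theory Num.Theory.

Local Open Scope classical_set_scope.
Local Open Scope nat_scope.

Definition is_least (A : set nat) (x : nat) : Prop :=
  A x /\ forall y, A y -> x <= y.

Definition unique_sum (A : set nat) (x : nat) : Prop :=
  exists! p : nat * nat, [/\ A p.1, A p.2, p.1 < p.2 & p.1 + p.2 = x].

(* The terms are indexed from 0. *)
Definition is_ulam_seq (n : nat) (u : nat -> nat) : Prop :=
  [/\ u 0 = 1, u 1 = n &
   forall k, is_least
     [set x | u k.+1 < x /\ unique_sum (u @` [set j | j <= k.+1]) x] (u k.+2)].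

(* For 2 <= n such a sequence exists and is unique: ulam_seqP, ulam_seq_uniq. *)
Definition ulam_seq (n : nat) : nat -> nat := xget (fun=> 0) (is_ulam_seq n).

Definition ulam (n : nat) : set nat := range (ulam_seq n).

(* The i-th run, 1 <= i, is [ab.1 i, ab.2 i]; the values at i = 0 play no role. *)
Definition is_runs (A : set nat) (ab : (nat -> nat) * (nat -> nat)) : Prop :=
  (forall i, 1 <= i -> ab.1 i <= ab.2 i /\ (ab.2 i).+1 < ab.1 i.+1) /\
  A = [set x | exists i, 1 <= i /\ ab.1 i <= x <= ab.2 i].

(* For 2 <= n the runs of U(1, n) exist and are unique: ulam_runsP, is_runs_uniq. *)
Definition ulam_runs (n : nat) : (nat -> nat) * (nat -> nat) :=
  xget (fun=> 0, fun=> 0) (is_runs (ulam n)).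

Definition run_lo (n i : nat) : nat := (ulam_runs n).1 i.
Definition run_hi (n i : nat) : nat := (ulam_runs n).2 i.

Definition rigid (R : realType) (M : nat) (B eps delta : R) (m p : nat -> int)
    (n : nat) : Prop :=
  [/\ 3 <= n,
   (4 * Num.max eps delta - B + 4 < n%:R)%R &
   forall i, 1 <= i <= M -> exists eps_i delta_i : R,
     [/\ (`|eps_i| < eps)%R, (`|delta_i| < delta)%R &
      forall N, N = n.-1 \/ N = n ->
        ((run_lo N i)%:R = (N%:R + B) * (m i)%:~R + eps_i)%R /\
        ((run_hi N i)%:R = (N%:R + B) * (p i)%:~R + delta_i)%R]].

Lemma is_least_exists (A : set nat) : A !=set0 -> exists x, is_least A x.
Proof.
move=> [x0 Ax0].
have exA : exists x, `[< A x >] by exists x0; apply/asboolP.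
case: (ex_minnP exA) => x /asboolP Ax xmin; exists x; split=> // y Ay.
exact/xmin/asboolP.
Qed.

Lemma is_least_uniq (A : set nat) x y : is_least A x -> is_least A y -> x = y.
Proof.
by move=> [Ax xm] [Ay ym]; apply/eqP; rewrite eqn_leq xm ?ym.
Qed.

Lemma unique_sum_top (A : set nat) a b : A a -> A b -> a < b ->
  (forall x, A x -> x <= a \/ x = b) -> unique_sum A (a + b).
Proof.
move=> Aa Ab ab Amax; exists (a, b); split=> [//|[x y] /= [Ax Ay xy exy]].
by have [?|?] := Amax _ Ax; have [?|?] := Amax _ Ay; congr pair; lia.
Qed.

Lemma is_ulam_seq_lt n u k : 2 <= n -> is_ulam_seq n u -> u k < u k.+1.
Proof. by move=> n2 [u0 u1 us]; case: k => [|k]; [rewrite u0 u1|case: (us k) => -[]]. Qed.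

Lemma ulam_seq_uniq n u v : is_ulam_seq n u -> is_ulam_seq n v -> u = v.
Proof.
move=> [u0 u1 us] [v0 v1 vs]; apply/funext => k.
suff: forall j, j <= k -> u j = v j by apply.
elim: k => [|k IH] j; first by rewrite leqn0 => /eqP ->; rewrite u0 v0.
rewrite leq_eqVlt => /orP[/eqP ->|]; last by rewrite ltnS; apply: IH.
case: k IH => [_|k IH]; first by rewrite u1 v1.
apply: is_least_uniq (us k) _; rewrite (IH k.+1) //.
suff -> : u @` [set j | j <= k.+1] = v @` [set j | j <= k.+1] by exact: vs.
by apply/seteqP; split=> _ [i /= ik <-]; exists i => //; rewrite IH.
Qed.

Lemma is_ulam_seq_exists n : 2 <= n -> exists v, is_ulam_seq n v.
Proof.
move=> n2.
pose next (s : seq nat) : nat :=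
  xget 0 (is_least [set x | last 0 s < x /\ unique_sum [set y | y \in s] x]).
pose pre (k : nat) : seq nat := iter k (fun s => rcons s (next s)) [:: 1; n].
pose u (k : nat) : nat := nth 0 (pre k) k.
have size_pre k : size (pre k) = k.+2.
  by elim: k => //= k IH; rewrite size_rcons IH.
have nth_pre k d j : j < k.+2 -> nth 0 (pre (d + k)) j = nth 0 (pre k) j.
  move=> jk; elim: d => //= d IH; rewrite nth_rcons size_pre.
  by rewrite (_ : j < _) ?IH //; lia.
have preE k j : j <= k.+1 -> nth 0 (pre k) j = u j.
  move=> jk; rewrite /u; have [kj|kj] := leqP k j.
    by rewrite -(subnK kj) nth_pre ?subnK.
  by rewrite -{1}(subnK (ltnW kj)) nth_pre.
have mem_pre k : [set y | y \in pre k] = u @` [set j | j <= k.+1].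
  apply/seteqP; split=> [x /= /(nthP 0) [j]|_ [j /= jk <-]].
    by rewrite size_pre => jk <-; exists j => //; rewrite preE.
  by rewrite -(preE _ _ jk); apply: mem_nth; rewrite size_pre.
have last_pre k : last 0 (pre k) = u k.+1.
  by rewrite -nth_last size_pre preE.
have uSS k : u k.+2 = next (pre k).
  by rewrite -(preE k.+1) //= nth_rcons size_pre ltnn eqxx.
exists u.
have step k : (forall i j, i < j -> j <= k.+1 -> u i < u j) -> 0 < u k -> is_least
   [set x | u k.+1 < x /\ unique_sum (u @` [set j | j <= k.+1]) x] (u k.+2).
  move=> incr upos; rewrite uSS /next mem_pre last_pre.
  have [|x xP] := @is_least_exists
    [set x | u k.+1 < x /\ unique_sum (u @` [set j | j <= k.+1]) x].
    exists (u k + u k.+1); split; first by lia.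
    apply: unique_sum_top; [by exists k => /=|by exists k.+1 => /=|exact: incr|].
    move=> _ [j /= jk <-]; have [->|jk1] := eqVneq j k.+1; first by right.
    left; have [->//|jk2] := eqVneq j k.
    by apply: ltnW; apply: incr; lia.
  exact: (xgetPex 0 (ex_intro _ x xP)).
have incr k : 0 < u k /\ forall i j, i < j -> j <= k.+1 -> u i < u j.
  elim: k => [|k [upos IH]].
    by split=> // i j; case: i => [|i]; case: j => [|[|j]] //.
  split; first by have := IH k k.+1 (leqnn _) (leqnn _); lia.
  move=> i j ij; rewrite leq_eqVlt => /orP[/eqP ej|]; last exact: IH.
  have [[lt _] _] := step k IH upos; subst j.
  have [->//|ik] := eqVneq i k.+1.
  by apply: ltn_trans lt; apply: IH; lia.
by split=> // k; have [? ?] := incr k; exact: step.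
Qed.

Lemma ulam_seqP n : 2 <= n -> is_ulam_seq n (ulam_seq n).
Proof. by move=> /is_ulam_seq_exists [v vP]; exact: (xgetPex _ (ex_intro _ v vP)). Qed.

Lemma ulam_unbounded n x : 2 <= n -> exists y, x <= y /\ ulam n y.
Proof.
move=> n2; have uP := ulam_seqP n2; exists (ulam_seq n x); split; last by exists x.
by elim: x => // x IH; apply: leq_ltn_trans IH (is_ulam_seq_lt _ n2 uP).
Qed.

Lemma ulam_gaps n x : 2 <= n -> exists y, x <= y /\ ~ ulam n y.
Proof.
move=> n2; have uP := ulam_seqP n2; apply: contrapT => nex.
have all y : x <= y -> ulam n y by move=> xy; apply: contrapT => h; apply: nex; exists y.
have incr i j : i < j -> ulam_seq n i < ulam_seq n j.
  elim: j => // j IH; rewrite ltnS leq_eqVlt => /orP[/eqP ->|/IH lt].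
    exact: (is_ulam_seq_lt _ n2 uP).
  exact: ltn_trans lt (is_ulam_seq_lt _ n2 uP).
have inc i j : ulam_seq n i < ulam_seq n j -> i < j.
  move=> lt; rewrite ltnNge leq_eqVlt; apply/negP => /orP[/eqP e|/incr].
    by rewrite e ltnn in lt.
  by move/(ltn_trans lt); rewrite ltnn.
have [k _ ek] := all (4 * x + 4 * n + 10) ltac:(lia).
case: uP => u0 u1 us.
have k2 : 2 <= k.
  by apply: (inc 1); rewrite ek u1; lia.
have [i ei] : exists i, k = i.+2 by exists (k - 2); lia.
subst k; have [[_ [p [_ puniq]]] _] := us i.
have mem y : x <= y -> y < ulam_seq n i.+2 -> (ulam_seq n @` [set j | j <= i.+1]) y.
  by move=> /all [j _ <-] /inc ji; exists j.
rewrite ek in mem puniq.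
have e1 : p = (x.+1, 3 * x + 4 * n + 9).
  by apply: puniq; split=> /=; [apply: mem; lia|apply: mem; lia|lia|lia].
have : p = (x.+2, 3 * x + 4 * n + 8).
  by apply: puniq; split=> /=; [apply: mem; lia|apply: mem; lia|lia|lia].
by rewrite e1 => -[]; lia.
Qed.

Lemma is_runs_exists (A : set nat) :
  (forall x, exists y, x <= y /\ A y) -> (forall x, exists y, x <= y /\ ~ A y) ->
  exists ab, is_runs A ab.
Proof.
move=> unb gap.
have [f fP] : exists f : nat -> nat, forall x, is_least [set y | x <= y /\ A y] (f x).
  have [|f fP] := @choice _ _ (fun x => is_least [set y | x <= y /\ A y]).
    by move=> x; exact: is_least_exists (unb x).
  by exists f.
have [g gP] : exists g : nat -> nat, forall x, is_least [set y | x <= y /\ ~ A y] (g x).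
  have [|g gP] := @choice _ _ (fun x => is_least [set y | x <= y /\ ~ A y]).
    by move=> x; exact: is_least_exists (gap x).
  by exists g.
pose a i := iter i.-1 (fun x => f (g x)) (f 0); pose b i := (g (a i)).-1.
have Aa i : A (a i).
  by rewrite /a; case: i.-1 => [|j] /=; [case: (fP 0) => -[]|case: (fP (g (iter j (fun x => f (g x)) (f 0)))) => -[]].
have ga i : a i < g (a i).
  have [[le nA] _] := gP (a i); rewrite ltn_neqAle le andbT.
  by apply/eqP => e; apply: nA; rewrite -e.
have aS i : 0 < i -> a i.+1 = f (g (a i)) by case: i.
have gf i : g (a i) < f (g (a i)).
  have [[le Af] _] := fP (g (a i)); rewrite ltn_neqAle le andbT.
  by apply/eqP => e; have [[_ +] _] := gP (a i); rewrite e; apply.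
exists (a, b); split=> [i i0|] /=.
  by rewrite aS // /b; have := ga i; have := gf i; lia.
apply/seteqP; split=> [x Ax|x /= [i [i0 /andP[ax xb]]]]; last first.
  apply: contrapT => nAx; have [_ /(_ x (conj ax nAx))] := gP (a i).
  by have := ga i; rewrite /b in xb; lia.
have grow i : i <= a i.+1.
  by elim: i => // i IH; rewrite aS //; have := ga i.+1; have := gf i.+1; lia.
have [i [i0 [ai xi]]] : exists i, 0 < i /\ a i <= x /\ x < a i.+1.
  have ex : exists i, x < a i.+1 by exists x.+1; exact: grow.
  case: (ex_minnP ex) => -[|i] xi imin.
    by have [_ /(_ x (conj (leq0n x) Ax))] := fP 0; rewrite /a /= in xi *; lia.
  exists i.+1; split=> //; split=> //; rewrite leqNgt; apply/negP => /imin.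
  by rewrite ltnn.
exists i; split=> //=; rewrite ai /b /=.
have [xg|gx] := ltnP x (g (a i)); first by lia.
have [_ /(_ x (conj gx Ax))] := fP (g (a i)); rewrite -aS //; lia.
Qed.

Lemma is_runs_uniq (A : set nat) ab ab' : is_runs A ab -> is_runs A ab' ->
  forall i, 1 <= i -> ab.1 i = ab'.1 i /\ ab.2 i = ab'.2 i.
Proof.
pose low (ab : (nat -> nat) * (nat -> nat)) i : nat := if i == 1 then 0 else (ab.2 i.-1).+1.
have mono c : is_runs A c -> forall i j, 1 <= i -> i < j -> c.2 i < c.1 j.
  move=> [h _] i; elim=> // j IH i1; rewrite ltnS leq_eqVlt => /orP[/eqP <-|ij].
    by have := h i i1; lia.
  by have := IH i1 ij; have := h j ltac:(lia); lia.
have lo c : is_runs A c -> forall i, 1 <= i -> is_least [set x | low c i <= x /\ A x] (c.1 i).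
  move=> cP i i1; have [h AE] := cP; split.
    split; last by rewrite AE; exists i; split=> //=; rewrite leqnn; case: (h i i1).
    by rewrite /low; case: eqP => // ne1; apply: (mono c cP); lia.
  move=> y [ly]; rewrite AE => -[j [j1 /andP[cy yc]]].
  have [ji|ij] := ltnP j i.
    exfalso; move: ly; rewrite /low; case: eqP => [|_]; first lia.
    have [<-|ne] := eqVneq j i.-1; first lia.
    by have := mono c cP j i.-1 j1 ltac:(lia); have := h i.-1 ltac:(lia); lia.
  have [->//|ne] := eqVneq i j.
  by have := mono c cP i j i1 ltac:(lia); have := h i i1; lia.
have hi c : is_runs A c -> forall i, 1 <= i -> is_least [set x | c.1 i <= x /\ ~ A x] (c.2 i).+1.
  move=> cP i i1; have [h AE] := cP; split.
    split; first by have := h i i1; lia.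
    rewrite AE => -[j [j1 /andP[cy yc]]].
    have [ji|ij|e] := ltngtP i j; last by subst; lia.
      have [e|ne] := eqVneq j i.+1; first by subst; have := h i i1; lia.
      by have := mono c cP i.+1 j isT ltac:(lia); have := h i i1; have := h i.+1 isT; lia.
    by have := mono c cP j i j1 ij; have := h i i1; lia.
  move=> y [ly nA]; rewrite ltnNge; apply/negP => yc; apply: nA.
  by rewrite AE; exists i; split=> //; rewrite ly.
move=> P P'; have key i : 1 <= i -> low ab i = low ab' i ->
    ab.1 i = ab'.1 i /\ ab.2 i = ab'.2 i.
  move=> i1 e; have e1 : ab.1 i = ab'.1 i.
    by apply: is_least_uniq (lo _ P i i1) _; rewrite e; exact: lo.
  split=> //; apply: succn_inj.
  by apply: is_least_uniq (hi _ P i i1) _; rewrite e1; exact: hi.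
elim=> // -[|i] IH _; first exact: key.
by apply: key => //; rewrite /low /=; have [] := IH isT => _ ->.
Qed.

Lemma ulam_runsP n : 2 <= n -> is_runs (ulam n) (ulam_runs n).
Proof.
move=> n2; have [||ab abP] := @is_runs_exists (ulam n).
- by move=> x; exact: ulam_unbounded.
- by move=> x; exact: ulam_gaps.
- exact: (xgetPex _ (ex_intro _ ab abP)).
Qed.

(* Main.v *)
(* It suffices to pass from N to N + 1.  Put L = N + B and mu = max eps delta.
   Let V be the union of the first M runs of U(1, N), and V' the union of the
   intervals [a_i + m_i, b_i + p_i] predicted for U(1, N + 1).  Whether an integer
   x has zero, one or several representations as a sum of two distinct elements of
   V depends only on how x compares with endpoint sums a_i + a_j, b_i + b_j up to
   small constants, and these lie close to integer multiples of L.  Since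
   L > 4 mu + 4, the points near distinct multiples of L do not interfere, so every
   x' has a counterpart x = x' - k whose comparisons in the world of L are those of
   x' in the world of L + 1.  Hence V' satisfies the recursion that characterises
   U(1, N + 1) up to b'_M + 1, because V satisfies that of U(1, N).  The data at
   N - 1 are only needed to exclude N = 3 and to identify m_1, p_1 and m_2. *)
Require Import Defs.
From mathcomp Require Import all_boot all_order all_algebra.
From mathcomp Require Import zify lra.
From mathcomp Require Import boolp classical_sets reals.
Set Implicit Arguments.
Unset Strict Implicit.
Unset Printing Implicit Defensive.
Import Order.TTheory GRing.Theory Num.Theory.
Local Open Scope classical_set_scope.
Local Open Scope nat_scope.

(** * Ulam sets characterised by a recursion on membership *)

(** Without 0 in the set, both summands of x are smaller than x, so only members below x matter. *)
Lemma unique_sum_ext (A B : set nat) x : ~ A 0 -> ~ B 0 ->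
  (forall y, y < x -> A y <-> B y) -> unique_sum A x <-> unique_sum B x.
Proof.
move=> A0 B0 AB.
have key (C D : set nat) (p : nat * nat) : ~ C 0 -> (forall y, y < x -> C y <-> D y) ->
    [/\ C p.1, C p.2, p.1 < p.2 & p.1 + p.2 = x] ->
    [/\ D p.1, D p.2, p.1 < p.2 & p.1 + p.2 = x].
  case: p => y z C0 CD /= [Cy Cz yz e].
  have y0 : y <> 0 by move=> y0; rewrite y0 in Cy.
  by split=> //; [apply/CD => //; lia|apply/CD => //; lia].
have BA y : y < x -> B y <-> A y by move=> /AB h; split=> /h.
split=> -[p [pP pu]]; exists p; split; try exact: key pP.
  by move=> q qP; apply: pu; exact: key qP.
by move=> q qP; apply: pu; exact: key qP.
Qed.

Lemma ulam_seq_mono n : 2 <= n -> {mono ulam_seq n : i j / i < j}.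
Proof.
move=> n2; apply: leqW_mono; apply: leq_mono.
by apply: homo_ltn => [|k]; [exact: ltn_trans|exact: is_ulam_seq_lt n2 (ulam_seqP n2)].
Qed.

Lemma ulam_pos n : 2 <= n -> ~ ulam n 0.
Proof.
move=> n2 [k _ uk]; have [u0 _ _] := ulam_seqP n2.
have := ulam_seq_mono n2 k 0; rewrite u0 uk ltn0; lia.
Qed.

(** Terms are positive and increasing, so those from x onwards never enter a sum equal to x; the
    prefixes in the recursion can be replaced by the whole set. *)
Lemma ulamP n x : 2 <= n ->
  ulam n x <-> [\/ x = 1, x = n | n < x /\ unique_sum (ulam n) x].
Proof.
move=> n2; have [u0 u1 us] := ulam_seqP n2; have um := ulam_seq_mono n2.
have prefix k y : ulam_seq n k.+1 < y -> y <= ulam_seq n k.+2 ->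
    unique_sum (ulam_seq n @` [set j | j <= k.+1]) y <-> unique_sum (ulam n) y.
  move=> ky yk; apply: unique_sum_ext; [|exact: ulam_pos|].
    by move=> [j _ uj]; apply: (ulam_pos n2); exists j.
  move=> z zy; split=> [[j _ <-]|[j _ ej]]; first by exists j.
  by exists j => //=; rewrite -ltnS -um ej (leq_trans zy).
split=> [[k _ <-]|].
  case: k => [|[|k]]; [by apply: Or31|by apply: Or32|].
  have [[lt un] _] := us k; apply: Or33; split; first by rewrite -[X in X < _]u1 um.
  exact/(prefix _ _ lt).
case=> [->|->|[nx un]]; [by exists 0|by exists 1|].
have ex : exists k, x <= ulam_seq n k.
  have [y [xy [k _ uk]]] := ulam_unbounded x n2.
  by exists k; rewrite uk.
case: (ex_minnP ex) => -[|[|k]] xk kmin; rewrite ?u0 ?u1 in xk; try lia.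
have kx : ulam_seq n k.+1 < x by rewrite ltnNge; apply/negP => /kmin; rewrite ltnn.
have [_ /(_ x)] := us k => h; exists k.+2 => //.
by apply/eqP; rewrite eqn_leq xk h //; split=> //; apply/(prefix k).
Qed.

(** Strong induction, since being a unique sum depends only on smaller members. It serves to
    recognise a predicted set as an initial part of U(1, n). *)
Lemma ulam_prefix n X (V : set nat) : 2 <= n -> ~ V 0 ->
  (forall x, x <= X -> V x <-> [\/ x = 1, x = n | n < x /\ unique_sum V x]) ->
  forall x, x <= X -> V x <-> ulam n x.
Proof.
move=> n2 V0 VP; elim/ltn_ind => x IH xX.
have un : unique_sum V x <-> unique_sum (ulam n) x.
  apply: unique_sum_ext => //; first exact: ulam_pos.
  by move=> y yx; apply: IH => //; lia.
by rewrite VP // ulamP // (propext un).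
Qed.

(** * Finite families of separated runs *)

Definition first_runs (a b : nat -> nat) (M : nat) : set nat :=
  [set x | exists i, 1 <= i <= M /\ a i <= x <= b i].

Definition separated (a b : nat -> nat) (M : nat) : Prop :=
  [/\ forall i, 1 <= i <= M -> 0 < a i <= b i &
      forall i, 1 <= i < M -> (b i).+1 < a i.+1].

Lemma separated_lt a b M i j : separated a b M ->
  1 <= i -> i < j -> j <= M -> (b i).+1 < a j.
Proof.
move=> [ab sep] i1; elim: j => // j IH; rewrite ltnS leq_eqVlt.
case/orP=> [/eqP <-|ij] jM; first by apply: sep; lia.
by have := IH ij (ltnW jM); have := ab j ltac:(lia); have := sep j ltac:(lia); lia.
Qed.

Lemma separated_le a b M i j : separated a b M ->
  1 <= i -> i <= j -> j <= M -> a i <= a j.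
Proof.
move=> s i1; rewrite leq_eqVlt => /orP[/eqP -> //|ij jM].
by have := separated_lt s i1 ij jM; have [ab _] := s; have := ab i ltac:(lia); lia.
Qed.

Lemma ulam_runs_separated n M : 2 <= n -> separated (run_lo n) (run_hi n) M.
Proof.
move=> n2; have [h AE] := ulam_runsP n2; split=> i iM; last by case: (h i ltac:(lia)).
have [ab _] := h i ltac:(lia); apply/andP; split=> //; rewrite lt0n; apply/eqP => e.
by apply: (ulam_pos n2); rewrite AE; exists i; rewrite -/(run_lo n i) e; split=> //; lia.
Qed.

Lemma ulam_first_runs n M x : 2 <= n -> x <= (run_hi n M).+1 -> 1 <= M ->
  ulam n x <-> first_runs (run_lo n) (run_hi n) M x.
Proof.
move=> n2 xM M1; have [h AE] := ulam_runsP n2; rewrite {1}AE; split.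
  move=> [i [i1 ix]]; exists i; split=> //; rewrite i1 leqNgt; apply/negP => Mi.
  have := separated_lt (ulam_runs_separated i n2) M1 Mi (leqnn i).
  by rewrite /run_lo in xM *; lia.
by move=> [i [iM ix]]; exists i; split=> //; lia.
Qed.

(** Agreement is required up to [(b M).+1], a gap of the given family, so that the right end of the
    last run is detected too. *)
Lemma runs_unique a b M n : 2 <= n -> 1 <= M -> separated a b M ->
  (forall x, x <= (b M).+1 -> first_runs a b M x <-> ulam n x) ->
  forall i, 1 <= i <= M -> run_lo n i = a i /\ run_hi n i = b i.
Proof.
move=> n2 M1 s VA; have [h AE] := ulam_runsP n2.
have inrun x : x <= (b M).+1 -> first_runs a b M x <->
    exists i, 1 <= i /\ run_lo n i <= x <= run_hi n i.
  by move=> /VA ->; rewrite AE.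
have rs k := ulam_runs_separated k n2.
have bM i : 1 <= i <= M -> b i <= b M.
  move=> /andP[i1]; rewrite leq_eqVlt => /orP[/eqP -> //|iM].
  by have := separated_lt s i1 iM (leqnn M); case: s => /(_ M ltac:(lia)); lia.
have [ab _] := s.
elim/ltn_ind => i IH iM.
have abi := ab i iM; have bMi := bM i iM.
(* By induction the earlier runs coincide and end before [a i], so the run of U(1, n) containing
   [a i] has index at least i. *)
have lo_le : run_lo n i <= a i.
  have [ki k1] : exists k, 1 <= k /\ run_lo n k <= a i <= run_hi n k.
    by apply/inrun; [lia|exists i; split=> //; lia].
  case: k1 => k1 kx; rewrite (leq_trans _ (proj1 (andP kx))) //.
  apply: (separated_le (rs ki)); rewrite ?leqnn //; first lia.
  rewrite leqNgt; apply/negP => kii; have [_ e] := IH ki kii ltac:(lia).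
  by have := separated_lt s k1 kii ltac:(lia); lia.
have lo_ge : a i <= run_lo n i.
  have [k [kM kx]] : first_runs a b M (run_lo n i).
    apply/inrun; first lia.
    by exists i; split; [lia|have [/(_ i ltac:(lia))] := rs i; lia].
  have [ki|ik] := ltnP k i; last first.
    by have := @separated_le a b M i k s ltac:(lia) ik ltac:(lia); lia.
  have [_ e] := IH k ki ltac:(lia).
  by have := @separated_lt _ _ i k i (rs i) ltac:(lia) ki (leqnn _); lia.
have lo : run_lo n i = a i by lia.
split=> //.
have hi_le : run_hi n i <= b i.
  rewrite leqNgt; apply/negP => bi.
  have [k [kM kx]] : first_runs a b M (b i).+1.
    by apply/inrun; [lia|exists i; split; lia].
  have [ki|ik|e] := ltngtP k i; last by subst; lia.
    by have := @separated_lt _ _ _ k i s ltac:(lia) ki ltac:(lia); lia.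
  by have := @separated_lt _ _ _ i k s ltac:(lia) ik ltac:(lia); lia.
have [//|hib] : run_hi n i = b i \/ run_hi n i < b i by lia.
have lohi : run_lo n i <= run_hi n i by have [/(_ i ltac:(lia))] := rs i; lia.
have [k [k1 kx]] : exists k, 1 <= k /\ run_lo n k <= (run_hi n i).+1 <= run_hi n k.
  by apply/inrun; [lia|exists i; split=> //; lia].
have [ki|ik|e] := ltngtP k i; last by subst; lia.
  by have := @separated_lt _ _ _ k i (rs i) k1 ki ltac:(lia); lia.
by have := @separated_lt _ _ _ i k (rs k) ltac:(lia) ik ltac:(lia); lia.
Qed.

Lemma ulam_first_terms n : 3 <= n ->
  [/\ run_lo n 1 = 1, run_hi n 1 = 1 & run_lo n 2 = n].
Proof.
move=> n3; have n2 : 2 <= n by lia.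
have [h AE] := ulam_runsP n2; have rs k := ulam_runs_separated k n2.
have inrun x : ulam n x <-> exists i, 1 <= i /\ run_lo n i <= x <= run_hi n i.
  by rewrite {1}AE.
have small x : ulam n x -> x = 1 \/ n <= x by move=> /(ulamP _ n2)[]; lia.
have lo1 : run_lo n 1 = 1.
  have [i [i1 ix]] : exists i, 1 <= i /\ run_lo n i <= 1 <= run_hi n i.
    by apply/inrun/ulamP => //; exact: Or31.
  have := @separated_le _ _ i 1 i (rs i) isT i1 (leqnn i).
  by have [/(_ 1 isT)] := rs 1; lia.
have lohi i : 1 <= i -> run_lo n i <= run_hi n i.
  by move=> i1; have [/(_ i ltac:(lia))] := rs i; lia.
have hi1 : run_hi n 1 = 1.
  have := lohi 1 isT; rewrite lo1 leq_eqVlt => /orP[/eqP //|hi1].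
  have /small : ulam n 2 by apply/inrun; exists 1; lia.
  lia.
split=> //.
have lt12 := @separated_lt _ _ 2 1 2 (rs 2) isT isT isT.
have /small : ulam n (run_lo n 2) by apply/inrun; exists 2; have := lohi 2 isT; lia.
have [i [i1 ix]] : exists i, 1 <= i /\ run_lo n i <= n <= run_hi n i.
  by apply/inrun/ulamP => //; exact: Or32.
have [e|i2] : i = 1 \/ 2 <= i by lia.
  by subst; lia.
have := @separated_le _ _ i 2 i (rs i) isT i2 (leqnn i); lia.
Qed.

(** * Unique sums read off from the endpoints of runs *)

(** Summands must be distinct, which excludes the two extreme sums when both come from the same
    run. *)
Definition has_sum (a b : nat -> nat) (i j x : nat) : bool :=
  if i == j then a i + a i < x < b i + b i
  else a i + a j <= x <= b i + b j.

(* Within one run the least doubly represented sum is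
   2a + 3 = a + (a + 3) = (a + 1) + (a + 2). *)
Definition has_two_sums (a b : nat -> nat) (i j x : nat) : bool :=
  if i == j then (a i + a i + 3 <= x) && (x + 3 <= b i + b i)
  else [&& a i < b i, a j < b j & a i + a j < x < b i + b j].

(** Ordered summands determine a pair of runs i <= j. Uniqueness thus splits into one possible pair
    of runs and a single sum within that pair. *)
Lemma unique_sum_runs a b M x : separated a b M ->
  unique_sum (first_runs a b M) x <->
  exists ij : nat * nat,
    [/\ 1 <= ij.1 <= ij.2, ij.2 <= M, has_sum a b ij.1 ij.2 x,
        ~~ has_two_sums a b ij.1 ij.2 x &
        forall i j, 1 <= i -> i <= j -> j <= M -> has_sum a b i j x -> (i, j) = ij].
Proof.
move=> s; have [ab _] := s.
have wit i j : 1 <= i -> i <= j -> j <= M -> has_sum a b i j x ->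
    exists y z, [/\ a i <= y <= b i, a j <= z <= b j, y < z & y + z = x].
  move=> i1 ij jM; rewrite /has_sum; have := ab i ltac:(lia); have := ab j ltac:(lia).
  case: eqP => [<-|ne] hj hi hx.
    by exists (maxn (a i) (x - b i)), (x - maxn (a i) (x - b i)); split; lia.
  have := @separated_lt _ _ _ i j s i1 ltac:(lia) jM => lt.
  by exists (maxn (a i) (x - b j)), (x - maxn (a i) (x - b j)); split; lia.
have tiw i j y z : 1 <= i <= M -> 1 <= j <= M -> a i <= y <= b i -> a j <= z <= b j ->
    y < z -> y + z = x -> i <= j /\ has_sum a b i j x.
  move=> iM jM iy jz yz e; have ij : i <= j.
    rewrite leqNgt; apply/negP => ji.
    by have := @separated_lt _ _ _ j i s ltac:(lia) ji ltac:(lia); lia.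
  by split=> //; rewrite /has_sum; case: eqP => [ei|_]; [subst|]; lia.
have mem i y : 1 <= i <= M -> a i <= y <= b i -> first_runs a b M y by exists i.
have same i j y : 1 <= i <= M -> 1 <= j <= M -> a i <= y <= b i -> a j <= y <= b j -> i = j.
  move=> iM jM iy jy; have [ij|ji|//] := ltngtP i j.
    by have := @separated_lt _ _ _ i j s ltac:(lia) ij ltac:(lia); lia.
  by have := @separated_lt _ _ _ j i s ltac:(lia) ji ltac:(lia); lia.
split.
  move=> [[y z] [/= [[i [iM iy]] [j [jM jz]] yz e] un]].
  have [ij hs] := tiw i j y z iM jM iy jz yz e.
  have all i' j' y' z' : 1 <= i' <= M -> 1 <= j' <= M -> a i' <= y' <= b i' ->
      a j' <= z' <= b j' -> y' < z' -> y' + z' = x -> (y, z) = (y', z').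
    by move=> ? ? ? ? ? ?; apply: un; split=> //=; [exact: (mem i')|exact: (mem j')].
  exists (i, j); split=> //=; [lia|lia| |].
    apply/negP; rewrite /has_two_sums; case: eqP => [ei|ne] h.
      subst j; have hi := ab i iM.
      (* [u] is the least admissible first summand; two representations would make [u.+1] admissible
         as well. *)
      set u := maxn (a i) (x - b i).
      have [] : (u, x - u) = (u.+1, x - u.+1); last lia.
      by rewrite -(all i i u (x - u)) -?(all i i u.+1 (x - u.+1)) // /u; lia.
    have hi := ab i iM; have hj := ab j jM.
    have lt := @separated_lt _ _ _ i j s ltac:(lia) ltac:(lia) ltac:(lia).
    set u := maxn (a i) (x - b j).
    have [] : (u, x - u) = (u.+1, x - u.+1); last lia.
    by rewrite -(all i j u (x - u)) -?(all i j u.+1 (x - u.+1)) // /u; lia.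
  move=> i' j' i1 ij' jM' /(wit _ _ i1 ij' jM') [y' [z' [iy' jz' yz' e']]].
  have [ey ez] := all i' j' y' z' ltac:(lia) ltac:(lia) iy' jz' yz' e'.
  by subst y' z'; congr pair; [apply: (@same _ _ y)|apply: (@same _ _ z)] => //; lia.
move=> [[i j] /= [/andP[i1 ij] jM hs nts un]].
have [y [z [iy jz yz e]]] := wit i j i1 ij jM hs.
exists (y, z); split=> /=.
  by split=> //; [apply: (mem i)|apply: (mem j)] => //; lia.
move=> [y' z'] /= [[i' [iM' iy']] [j' [jM' jz']] yz' e'].
have [ij' hs'] := tiw i' j' y' z' iM' jM' iy' jz' yz' e'.
have [ei ej] := un i' j' ltac:(lia) ij' ltac:(lia) hs'; subst i' j'.
suff: y = y' by move=> ey; congr pair; lia.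
move: nts; rewrite /has_two_sums; case: eqP => [ei|ne].
  by subst j; lia.
by lia.
Qed.

(** * Transfer of comparisons from L + 1 to L *)

(* With [L] for N + B, a cut [s = L j + g] of U(1, N) becomes [s + j] in
   U(1, N + 1).  The even multiples of [L] get a wider margin because only the
   sums of two terms of the same run, which sit there, have cuts at offset 3. *)
Definition same_cuts (R : realType) (L mu : R) (x x' : nat) : Prop :=
  (forall j s : nat, (- (2 * mu) < s%:R - L * j%:R < 2 * mu + 1)%R ->
     (s <= x) = (s + j <= x')) /\
  (forall j s : nat, (- (2 * mu) - 2 < s%:R - L * (j + j)%:R < 2 * mu + 3)%R ->
     (s <= x) = (s + (j + j) <= x')).

(* Take [x = x' - k] with [k] increasing by one at a threshold strictly between
   the cuts near [L k] and those near [L (k + 1)]; the margins of an even and an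
   odd multiple add up to 4 mu + 3, so there is room as soon as [4 mu + 4 < L]. *)
Lemma cut_transfer (R : realType) (L mu : R) (x' : nat) :
  (0 <= mu)%R -> (4 * mu + 4 < L)%R -> exists x, same_cuts L mu x x'.
Proof.
move=> mu0 Lmu.
have below (x k s j : nat) : (s%:R <= x%:R :> R)%R -> (j <= k)%N -> (s <= x)%N = (s + j <= x + k)%N.
  by rewrite ler_nat => sx jk; lia.
have above (x k s j : nat) : (x%:R < s%:R :> R)%R -> (k <= j)%N -> (s <= x)%N = (s + j <= x + k)%N.
  by rewrite ltr_nat => sx jk; lia.
have mulL (j k d : nat) : j + d <= k -> (L * j%:R + L * d%:R <= L * k%:R)%R.
  by move=> jk; rewrite -mulrDr -natrD ler_wpM2l ?ler_nat //; lra.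
(* Cuts near L k are preserved exactly by x = x' - k. The window for x lies above the cuts near
   smaller multiples and below those near larger ones; its two forms reflect the parity of k. *)
have pick (k x : nat) : x' = x + k ->
   ((exists q, k = q + q /\ L * k%:R - L + 2 * mu + 1 < x%:R <= L * k%:R + 2 * mu + 4) \/
    (exists q, k = (q + q).+1 /\ L * k%:R - L + 2 * mu + 3 < x%:R <= L * k%:R + 2 * mu + 2))%R ->
   exists x, same_cuts L mu x x'.
  move=> -> H; exists x; split=> j s sj.
    have [jk|kj|->] := ltngtP j k; last by lia.
      apply: below; last lia.
      by have := mulL j k 1 ltac:(lia); case: H => -[q [_ xq]]; lra.
    apply: above; last lia.
    by have := mulL k j 1 ltac:(lia); case: H => -[q [_ xq]]; lra.
  have [jk|kj|e] := ltngtP (j + j) k; last by rewrite e; lia.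
    apply: below; last lia.
    case: H => -[q [kq xq]].
      by have := mulL (j + j) k 2 ltac:(lia); lra.
    by have := mulL (j + j) k 1 ltac:(lia); lra.
  apply: above; last lia.
  case: H => -[q [kq xq]].
    by have := mulL k (j + j) 2 ltac:(lia); lra.
  by have := mulL k (j + j) 1 ltac:(lia); lra.
have pos : (0 < 2 * (L + 1))%R by lra.
(* Now x' lies between 2q (L + 1) and (2q + 2) (L + 1), so k is 2q, 2q + 1 or 2q + 2. The thresholds
   below are the upper window ends with k added. *)
pose q := Num.truncn (x'%:R / (2 * (L + 1)))%R.
have /truncn_itv : (0 <= x'%:R / (2 * (L + 1)) :> R)%R by apply: divr_ge0 => //; lra.
rewrite -/q ler_pdivlMr // ltr_pdivrMr // -addn1 natrD => /andP[lo hi].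
have q0 : (0 <= q%:R :> R)%R by [].
have Lq : (0 <= L * q%:R :> R)%R by apply: mulr_ge0 => //; lra.
have sub (k : nat) : (k%:R <= x'%:R :> R)%R -> ((x' - k)%:R = x'%:R - k%:R :> R)%R /\ x' = x' - k + k.
  by rewrite ler_nat => kx; rewrite natrB // subnK.
have [c1|c1] := lerP (x'%:R) ((L + 1) * (q + q)%:R + 2 * mu + 4)%R.
  have [e1 e2] := sub (q + q) ltac:(rewrite natrD; nra).
  apply: pick e2 _; left; exists q; split=> //.
  by rewrite e1 natrD in c1 *; lra.
have [c2|c2] := lerP (x'%:R) ((L + 1) * (q + q).+1%:R + 2 * mu + 2)%R.
  have [e1 e2] := sub (q + q).+1 ltac:(rewrite natrD in c1; rewrite -addn1 !natrD; nra).
  apply: pick e2 _; right; exists q; split=> //.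
  by rewrite e1; rewrite -addn1 !natrD in c1 c2 *; lra.
have [e1 e2] := sub (q.+1 + q.+1) ltac:(rewrite -addn1 !natrD in c2; rewrite -addn1 !natrD; nra).
apply: pick e2 _; left; exists q.+1; split=> //.
by rewrite e1; rewrite -addn1 !natrD in c2 *; lra.
Qed.

(** [has_sum] and [has_two_sums] depend only on these comparisons; offsets above 1 occur only for i
    = j. *)
Lemma unique_sum_transfer a b a' b' M x x' :
  separated a b M -> separated a' b' M ->
  (forall i, 1 <= i <= M -> (a i < b i) = (a' i < b' i)) ->
  (forall i j t, 1 <= i <= M -> 1 <= j <= M -> t <= (if i == j then 3 else 1) ->
    (a i + a j + t <= x) = (a' i + a' j + t <= x') /\
    (x + t <= b i + b j) = (x' + t <= b' i + b' j)) ->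
  unique_sum (first_runs a b M) x <-> unique_sum (first_runs a' b' M) x'.
Proof.
move=> s s' lt cut.
have hsE i j : 1 <= i <= M -> 1 <= j <= M -> has_sum a b i j x = has_sum a' b' i j x'.
  move=> iM jM; have := cut i j; rewrite /has_sum; case: eqP => [<-|_] c.
    by have [] := c 1 iM iM isT; lia.
  by have [] := c 0 iM jM isT; lia.
have htE i j : 1 <= i <= M -> 1 <= j <= M ->
    has_two_sums a b i j x = has_two_sums a' b' i j x'.
  move=> iM jM; have := cut i j; rewrite /has_two_sums; case: eqP => [<-|_] c.
    by have [-> ->] := c 3 iM iM isT.
  by have [] := c 1 iM jM isT; rewrite !lt // !addn1 => -> ->.
rewrite !unique_sum_runs //.
split=> -[[i j] /= [ij jM hs ht un]]; exists (i, j); split=> //=.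
- by rewrite -hsE //; lia.
- by rewrite -htE //; lia.
- by move=> i' j' i1 ij' jM'; rewrite -hsE; [exact: un|lia|lia].
- by rewrite hsE //; lia.
- by rewrite htE //; lia.
- by move=> i' j' i1 ij' jM'; rewrite hsE; [exact: un|lia|lia].
Qed.

(** * The step from n to n + 1 and the theorem *)

(** U(1, 2) starts 1, 2, whereas the first run of U(1, 3) is {1}; this will exclude n = 3. *)
Lemma run_hi_2_1 : 2 <= run_hi 2 1.
Proof.
have [_ AE] := ulam_runsP (leqnn 2); have rs k := @ulam_runs_separated 2 k isT.
have [i [i1 ix]] : exists i, 1 <= i /\ run_lo 2 i <= 2 <= run_hi 2 i.
  have : ulam 2 2 by apply/ulamP => //; exact: Or32.
  by rewrite {1}AE.
have [ab _] := rs 1; have lo1 := ab 1 isT.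
have [e|i2] : i = 1 \/ 1 < i by lia.
  by subst i; lia.
by have := @separated_lt _ _ i 1 i (rs i) isT i2 (leqnn i); lia.
Qed.

(** [runs_unique] and [ulam_prefix] reduce the claim to checking the recursion of U(1, n + 1) for
    the predicted runs, and each x' is checked through its counterpart x. *)
Lemma run_shift (R : realType) (L mu : R) (n M : nat) (m p : nat -> nat) :
  3 <= n -> 2 <= M -> (1 <= mu)%R -> (4 * mu + 4 < L)%R ->
  m 1 = 0 -> p 1 = 0 -> m 2 = 1 ->
  (forall i, (1 <= i <= M)%N ->
     `|(run_lo n i)%:R - L * (m i)%:R| < mu /\ `|(run_hi n i)%:R - L * (p i)%:R| < mu)%R ->
  forall i, 1 <= i <= M ->
    run_lo n.+1 i = run_lo n i + m i /\ run_hi n.+1 i = run_hi n i + p i.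
Proof.
move=> n3 M2 mu1 Lmu m1 p1 m2; set a := run_lo n; set b := run_hi n => E.
have n2 : 2 <= n by lia.
have M1 : 1 <= M by lia.
have s : separated a b M := ulam_runs_separated M n2.
have [ab sep] := s.
have mulL (j k : nat) : j < k -> (L * j%:R + L <= L * k%:R)%R.
  move=> jk; rewrite -[X in (_ + X)%R]mulr1 -mulrDr natr1.
  by rewrite ler_wpM2l ?ler_nat //; lra.
have E' i : 1 <= i <= M ->
    (- mu < (a i)%:R - L * (m i)%:R < mu /\ - mu < (b i)%:R - L * (p i)%:R < mu)%R.
  by move=> /E; rewrite !ltr_norml.
(* Out of order, the multiples would differ by at least L > 2 mu, more than the two errors can
   compensate. *)
have mp i : 1 <= i <= M -> m i <= p i.
  move=> iM; rewrite leqNgt; apply/negP => /mulL.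
  have [] := E' i iM; have /andP[_] := ab i iM; rewrite -(ler_nat R); lra.
have pm i : 1 <= i < M -> p i <= m i.+1.
  move=> iM; rewrite leqNgt; apply/negP => /mulL.
  have [] := E' i ltac:(lia); have [] := E' i.+1 ltac:(lia).
  by have := ltnW (ltnW (sep i iM)); rewrite -(ler_nat R); lra.
pose a' i := a i + m i; pose b' i := b i + p i.
have s' : separated a' b' M.
  split=> i iM; rewrite /a' /b'; first by have := ab i iM; have := mp i iM; lia.
  by have := sep i iM; have := pm i iM; lia.
have lt i : 1 <= i <= M -> (a i < b i) = (a' i < b' i).
  move=> iM; rewrite /a' /b'; have := mp i iM; rewrite leq_eqVlt => /orP[/eqP e|mlt]; first lia.
  have -> : a i < b i.
    rewrite -(ltr_nat R); have [] := E' i iM; have := mulL _ _ mlt; lra.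
  by have := ab i iM; lia.
have [lo1 hi1 lo2] := ulam_first_terms n3.
have nS2 : 2 <= n.+1 by lia.
apply: (@runs_unique a' b' M) => //.
apply: ulam_prefix => //.
  by move=> [i [iM]]; have [ab' _] := s'; have := ab' i iM; lia.
move=> x' xM.
have [x [gen dbl]] := cut_transfer x' (le_trans ler01 mu1) Lmu.
have cut i j t : 1 <= i <= M -> 1 <= j <= M -> t <= (if i == j then 3 else 1) ->
    (a i + a j + t <= x) = (a' i + a' j + t <= x') /\
    (x + t <= b i + b j) = (x' + t <= b' i + b' j).
  move=> iM jM tij; have [Ei1 Ei2] := E' i iM; have [Ej1 Ej2] := E' j jM.
  have abi := ab i iM; have abj := ab j jM.
  have t0 : (0 <= t%:R :> R)%R by [].
  (* Upper bounds become negated cuts at [b i + b j + 1 - t]; [tb] makes this truncated subtraction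
     exact. *)
  have tb : t <= b i + b j + 1 by clear -tij abi abj; case: eqP tij => [<-|_]; lia.
  have e2 : ((b i + b j + 1 - t)%:R = (b i)%:R + (b j)%:R + 1 - t%:R :> R)%R.
    by rewrite natrB ?natrD.
  suff [h1 h2] : (a i + a j + t <= x) = (a i + a j + t + (m i + m j) <= x') /\
      (b i + b j + 1 - t <= x) = (b i + b j + 1 - t + (p i + p j) <= x').
    have -> : a' i + a' j + t = a i + a j + t + (m i + m j) by rewrite /a' addnACA addnAC.
    split=> //; have -> : (x + t <= b i + b j) = ~~ (b i + b j + 1 - t <= x).
      by clear -tb; lia.
    by rewrite h2 /b'; clear -tb; lia.
  case: eqP tij => [eij|_] tij.
    subst j; have t3 : (t%:R <= 3 :> R)%R by rewrite (ler_nat R t 3).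
    by split; apply: dbl; rewrite ?e2 ?natrD; lra.
  have t1 : (t%:R <= 1 :> R)%R by rewrite (ler_nat R t 1).
  by split; apply: gen; rewrite ?e2 ?natrD; lra.
have cut1 i : 1 <= i <= M -> (a i <= x) = (a' i <= x') /\ (b i < x) = (b' i < x').
  move=> iM; have [Ei1 Ei2] := E' i iM.
  by split; [apply: gen; lra|rewrite (gen (p i)) // -addn1 natrD; lra].
have VE : first_runs a' b' M x' <-> first_runs a b M x.
  split=> -[i [iM ix]]; exists i; split=> //; have := cut1 i iM; lia.
(* The cut at [(b M).+2] has offset below mu + 2, within the margin 2 mu + 1 because 1 <= mu. *)
have xb : x <= (b M).+1.
  have [_ EM] := E' M ltac:(lia).
  have : ((b M).+2 <= x) = ((b M).+2 + p M <= x').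
    by apply: gen; rewrite -addn2 natrD; lra.
  by rewrite /b' in xM; lia.
rewrite VE -(ulam_first_runs n2) // ulamP //.
have eun : unique_sum (ulam n) x = unique_sum (first_runs a' b' M) x'.
  apply/propext; apply: (iff_trans _ (unique_sum_transfer s s' lt cut)).
  apply: unique_sum_ext; first exact: ulam_pos.
    by move=> [i [iM]]; have := ab i iM; lia.
  by move=> y yx; apply: ulam_first_runs => //; rewrite -/b; lia.
rewrite eun.
have [c1a c1b] := cut1 1 ltac:(lia); have [c2 _] := cut1 2 ltac:(lia).
(* Since n is [a 2] with coefficient 1, the cut just after n moves by 1; hence x = n exactly when x'
   = n + 1. *)
have c3 : (n.+1 <= x) = (n.+1 + 1 <= x').
  have [+ _] := E' 2 ltac:(lia); rewrite /a lo2 m2 => En.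
  by apply: gen; rewrite -addn1 natrD; lra.
rewrite /a /b /a' /b' /a /b lo1 hi1 lo2 m1 p1 m2 in c1a c1b c2.
have -> : (x = 1) = (x' = 1) by apply/propext; lia.
have -> : (x = n) = (x' = n.+1) by apply/propext; lia.
by have -> : (n < x) = (n.+1 < x') by lia.
Qed.

Theorem theorem3p2 (R : realType) (M N0 : nat) (B eps delta : R)
    (m p : nat -> int) (hM : 1 <= M) :
  rigid M B eps delta m p N0 ->
  forall N : nat, N0 < N -> rigid M B eps delta m p N.
Proof.
move=> r0; suff step n : rigid M B eps delta m p n -> rigid M B eps delta m p n.+1.
  by elim=> // N IH; rewrite ltnS leq_eqVlt => /orP[/eqP <-|/IH]; exact: step.
move=> {r0 N0} [n3 large rig].
set mu : R := Num.max eps delta in large; pose L : R := (n%:R + B)%R.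
have mue : (eps <= mu)%R by rewrite le_max lexx.
have mud : (delta <= mu)%R by rewrite le_max lexx orbT.
have Lmu : (4 * mu + 4 < L)%R by rewrite /L; lra.
have n1 : ((n.-1)%:R = n%:R - 1 :> R)%R by rewrite -subn1 natrB //; lia.
have mu0 : (0 <= mu)%R.
  have [e [d [he _ _]]] := rig 1 ltac:(lia); have := normr_ge0 e; lra.
(* A negative coefficient would give a value of at most -L + mu < 0. *)
have int_ge0 (z : int) (c d : R) : (`|d| < mu -> 0 <= c -> c = L * z%:~R + d -> (0 <= z))%R.
  rewrite ltr_norml => hd c0 e; rewrite leNgt; apply/negP => z0.
  have : (z%:~R <= -1 :> R)%R by rewrite -[(-1)%R]/((-1)%:~R)%R ler_int; lia.
  nra.
have m0 i : 1 <= i <= M -> (0 <= m i)%R.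
  move=> /rig [e [d [he hd /(_ n (or_intror erefl)) [h _]]]].
  by apply: (int_ge0 (m i) (run_lo n i)%:R%R e) => //; lra.
have p0 i : 1 <= i <= M -> (0 <= p i)%R.
  move=> /rig [e [d [he hd /(_ n (or_intror erefl)) [_ h]]]].
  by apply: (int_ge0 (p i) (run_hi n i)%:R%R d) => //; lra.
(* The errors are common to n - 1 and n, so subtraction leaves exactly the coefficient. *)
have diff i : 1 <= i <= M -> (((run_lo n i)%:Z = (run_lo n.-1 i)%:Z + m i) /\
    ((run_hi n i)%:Z = (run_hi n.-1 i)%:Z + p i))%R.
  move=> /rig [e [d [he hd h]]].
  have [h1 h2] := h n (or_intror erefl); have [h3 h4] := h n.-1 (or_introl erefl).
  rewrite n1 in h3 h4.
  split; apply: (@intr_inj R); rewrite rmorphD /= -!pmulrn; lra.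
have hi1 : run_hi n 1 = 1 by have [] := ulam_first_terms n3.
have n4 : 3 <= n.-1.
  have [e|] : n = 3 \/ 3 <= n.-1 by lia.
    (* Here 1 = [run_hi 2 1] + [p 1] would force [p 1] < 0. *)
    have [_] := diff 1 ltac:(lia); have := p0 1 ltac:(lia); have := run_hi_2_1.
    by rewrite hi1 e /=; lia.
  by [].
have [lo1 _ lo2] := ulam_first_terms n3.
have [lo1' hi1' lo2'] := ulam_first_terms n4.
have [m1 p1] : m 1 = 0%R /\ p 1 = 0%R.
  by have [] := diff 1 ltac:(lia); rewrite lo1 hi1 lo1' hi1'; lia.
have shift i : 1 <= i <= M ->
    run_lo n.+1 i = run_lo n i + `|m i| /\ run_hi n.+1 i = run_hi n i + `|p i|.
  (* For M = 1 rigidity does not control [m 2], but the first run is {1} on both sides. *)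
  have [e1|M2] : M = 1 \/ 2 <= M by lia.
    rewrite e1 => i1; have -> : i = 1 by lia.
    have [-> -> _] := @ulam_first_terms n.+1 ltac:(lia).
    by rewrite lo1 hi1 m1 p1.
  apply: (@run_shift R L mu n M (fun i => `|m i|) (fun i => `|p i|)) => //.
  (* As [m 1] = 0, the left end 1 of the first run is itself the error, hence 1 < mu. *)
  - have [e [d [he hd /(_ n (or_intror erefl)) [h _]]]] := rig 1 ltac:(lia).
    by move: h he; rewrite lo1 m1 mulr0 add0r => <-; rewrite normr1; lra.
  - by rewrite m1.
  - by rewrite p1.
  - by have [+ _] := diff 2 ltac:(lia); rewrite lo2 lo2'; lia.
  move=> j jM; have [e [d [he hd /(_ n (or_intror erefl)) [h1 h2]]]] := rig j jM.
  rewrite h1 h2 -/L !pmulrn !gez0_abs ?m0 ?p0 //.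
  by rewrite ![(L * _ + _)%R]addrC !addrK; split; lra.
split; [lia|by rewrite -/mu -addn1 natrD; lra|].
move=> i iM; have [e [d [he hd h]]] := rig i iM; exists e, d; split=> // N [->|->] /=.
  by apply: h; right.
have [h1 h2] := h n (or_intror erefl); have [-> ->] := shift i iM.
rewrite -addn1 !natrD h1 h2 [(`|m i|%N)%:R%R]pmulrn [(`|p i|%N)%:R%R]pmulrn.
by rewrite !gez0_abs ?m0 ?p0 //; split; lra.
Qed.
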